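(* Let $(X,d,\mu)$, $\Omega$, $\theta\in[0,1)$, the boundary measure $\mathscr H$ on $\partial\Omega$ and the double-phase function $\mathcal H$ be as in the context. Suppose that $\Omega$ is bounded and that $\mathcal H$ satisfies the local comparability condition on $\overline\Omega$. Then there is a constant $C>0$ such that for every $g\in L^{\mathcal H}(\Omega)$, $$\int_{\partial\Omega}\mathcal H\bigl(z,\mathcal M_\theta g(z)\bigr)\,d\mathscr H(z)\le C\int_\Omega \mathcal H\bigl(x,C|g(x)|\bigr)\,d\mu(x).$$
   Context: Setting. $(X,d,\mu)$ is a complete metric measure space, where $\mu$ is a $\sigma$-finite Borel regular measure with $0<\mu(B(x,r))<\infty$ for every open ball. $\Omega\subset X$ is a domain such that $0<\mu(B(x,r)\cap\Omega)<\infty$ for all $x\in\overline\Omega$, $r>0$, and $\mu$ satisfies the restricted doubling condition on $\Omega$: there is $C\ge1$ with $\mu(B(x,2r)\cap\Omega)\le C\mu(B(x,r)\cap\Omega)$ for all $x\in\overline\Omega$, $r>0$. $\mathscr H$ is a $\sigma$-finite Borel regular measure on $\partial\Omega$ satisfying, for a fixed $0\le\theta<1$, the upper codimension-$\theta$ condition: there is $C_\theta>0$ with $\mathscr H(B(x,r)\cap\partial\Omega)\le C_\theta\, r^{-\theta}\mu(B(x,r)\cap\Omega)$ for all $x\in\partial\Omega$, $r>0$. Double-phase function. $\mathcal H(x,\xi)=\xi^{p(x)}+a(x)\xi^{q(x)}$ for $x\in\overline\Omega$, $\xi\ge0$ (with $\mathcal H(x,\infty)=\infty$), where $p,q,a$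 are measurable on $\overline\Omega$, $1<p(x)<q(x)<\infty$ for all $x$, $1<p^-:=\operatorname{ess\,inf}p\le p^+:=\operatorname{ess\,sup}p<\infty$, $1<q^-:=\operatorname{ess\,inf}q\le q^+:=\operatorname{ess\,sup}q<\infty$, and $0\le a\in L^\infty$. These conditions are assumed on $\overline\Omega$ with respect to $\mu$, and on $\partial\Omega$ with respect to $\mathscr H$. $L^{\mathcal H}(\Omega)$ is the space of measurable $u$ on $\Omega$ with $\varrho_{\mathcal H}(u)=\int_\Omega\mathcal H(x,|u|)\,d\mu<\infty$. Local comparability. $\mathcal H$ satisfies the local comparability condition on $E$ if there exist $C\ge1$ and $R_0>0$ such that for every ball $B\subset X$ of radius less than $R_0$, all $x,y\in B\cap E$ and all $\xi\in[0,\infty)$, $\mathcal H(x,\xi)\le C\,\mathcal H(y,C\xi)$. Fractional maximal operator. For $g\in L^1_{\mathrm{loc}}(\Omega)$ (integrable on bounded subsets of $\Omega$) and $z\in\partial\Omega$, $$\mathcal M_\theta g(z)=\sup_{0<r<2\operatorname{diam}(\partial\Omega)} r^\theta\,\frac1{\mu(B(z,r)\cap\Omega)}\int_{B(z,r)\cap\Omega}|g|\,d\mu .$$ *)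

(* Defs.v *)
From HB Require Import structures.
From mathcomp Require Import all_boot all_order all_algebra.
From mathcomp Require Import all_classical all_reals all_analysis.
From mathcomp Require Import measurable_realfun ess_sup_inf.

Set Implicit Arguments.
Unset Strict Implicit.
Unset Printing Implicit Defensive.

Import Order.TTheory GRing.Theory Num.Theory.

Local Open Scope classical_set_scope.
Local Open Scope ring_scope.
Local Open Scope ereal_scope.

(* The base point only excludes the empty space; the library needs it to form
   the Caratheodory sigma-algebra. *)
#[short(type="completeMetricType")]
HB.structure Definition CompleteMetric (R : numDomainType) :=
  { T of Complete T & PseudoPointedMetric R T & Metric R T }.

Section metric_notions.
Context {R : realType} {X : completeMetricType R}.
Implicit Types A E : set X.

Definition boundary A : set X := closure A `\` interior A.

Definition metric_bounded A := exists (x : X) (r : R), A `<=` ball x r.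

Definition diam A : \bar R :=
  ereal_sup [set (mdist x y)%:E | x in A & y in A].

Definition domain A := [/\ open A, connected A & A !=set0].

(* As usual in metric measure theory, a Borel regular measure is an outer
   measure defined on all subsets; "measurable" means Caratheodory
   measurable. *)
Definition borel_regular (mu : {outer_measure set X -> \bar R}) :=
  (forall B, <<s @open X >> B -> mu.-caratheodory B) /\
  (forall A, exists B, [/\ <<s @open X >> B, A `<=` B & mu B = mu A]).

Definition restricted_doubling (mu : {outer_measure set X -> \bar R})
    (Omega : set X) :=
  exists2 C : R, (1 <= C)%R & forall (x : X) (r : R),
    closure Omega x -> (0 < r)%R ->
    mu (ball x (2 * r)%R `&` Omega) <= C%:E * mu (ball x r `&` Omega).

Definition upper_codimension (mu nu : {outer_measure set X -> \bar R})
    (Omega : set X) (theta : R) :=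
  exists2 C : R, (0 < C)%R & forall (x : X) (r : R),
    boundary Omega x -> (0 < r)%R ->
    nu (ball x r `&` boundary Omega)
      <= C%:E * (r `^ (- theta))%:E * mu (ball x r `&` Omega).

End metric_notions.

(* The measure induced by an outer measure on its Caratheodory sigma-algebra. *)
Definition cara_measure (R : realType) (X : pointedType)
    (mu : {outer_measure set X -> \bar R}) :
  {measure set (caratheodory_type mu) -> \bar R} :=
  (mu : set (caratheodory_type mu) -> \bar R).

Section essential_bounds_on_a_set.
Context d {T : measurableType d} {R : realType}.
Variables (m : {measure set T -> \bar R}) (D : set T).

(* Outside D the function is replaced by the neutral value for the bound at
   hand, so that only the points of D matter. *)
Definition ess_inf_on (f : T -> R) : \bar R :=
  ess_inf m (patch (fun=> +oo) D (EFin \o f)).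

Definition ess_sup_on (f : T -> R) : \bar R :=
  ess_sup m (patch (fun=> -oo) D (EFin \o f)).

(* The inequalities p^- <= p^+ and q^- <= q^+ are automatic when m D > 0; they
   are left out so that a null boundary measure, for which p^- = +oo and
   p^+ = -oo, is not excluded. *)
Definition double_phase_data (p q a : T -> R) :=
  [/\ [/\ measurable_fun D p, measurable_fun D q & measurable_fun D a],
      forall x, D x -> [/\ 1 < p x, p x < q x & 0 <= a x]%R,
      1 < ess_inf_on p /\ ess_sup_on p < +oo,
      1 < ess_inf_on q /\ ess_sup_on q < +oo
    & ess_sup_on (fun x => `|a x|%R) < +oo].

End essential_bounds_on_a_set.

(* For p x, q x > 0 and a x >= 0 this takes the value +oo at xi = +oo, even
   where a x = 0, since 0 * +oo = 0 in \bar R. *)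
Definition double_phase (R : realType) (X : Type) (p q a : X -> R)
    (x : X) (xi : \bar R) : \bar R :=
  xi `^ p x + (a x)%:E * xi `^ q x.

Definition local_comparability (R : realType) (X : completeMetricType R)
    (H : X -> \bar R -> \bar R) (E : set X) :=
  exists C R0 : R, [/\ (1 <= C)%R, (0 < R0)%R &
    forall (c : X) (r : R), (0 < r < R0)%R ->
    forall x y : X, (ball c r `&` E) x -> (ball c r `&` E) y ->
    forall xi : R, (0 <= xi)%R ->
      H x xi%:E <= C%:E * H y (C * xi)%:E].

Section modular_space.
Context {R : realType} {X : completeMetricType R}.
Variables (mu : {outer_measure set X -> \bar R}) (Omega : set X).

Definition modular (H : X -> \bar R -> \bar R) (u : X -> \bar R) : \bar R :=
  \int[cara_measure mu]_(x in Omega) H x `|u x|.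

Definition modular_space (H : X -> \bar R -> \bar R) : set (X -> \bar R) :=
  [set u : X -> \bar R | measurable_fun (Omega : set (caratheodory_type mu)) u
                        /\ modular H u < +oo].

(* The supremum is taken in [0, +oo]: it is 0 if the range of r is empty,
   which happens when the boundary of Omega is a single point. *)
Definition frac_maximal (theta : R) (g : X -> \bar R) (z : X) : \bar R :=
  maxe 0 (ereal_sup
    [set (r `^ theta)%:E * (mu (ball z r `&` Omega))^-1
         * \int[cara_measure mu]_(x in ball z r `&` Omega) `|g x|
    | r in [set r : R | (0 < r)%R /\ r%:E < 2%:E * diam (boundary Omega)]]).

End modular_space.

(* Main.v *)
(* Omega is totally bounded, by boundedness and doubling, and connected, so
   chaining local comparability makes it global: H x xi <= K * H y (K * xi) for
   all x, y in the closure. Freezing y = x0 replaces H by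
   xi `^ p0 + a0 * xi `^ q0 with constant exponents p0, q0 > 1, and it remains to
   bound the fractional maximal operator from L^p(Omega, mu) to
   L^p(boundary, nu) for p > 1. This is a Marcinkiewicz argument: the Vitali
   covering lemma, doubling and the codimension condition give the weak type
   estimate nu {M g > t} <= C / t * int_{|g| > t / K} |g| dmu, which is summed
   over the levels t = 2 ^ j * s. *)
Require Import Defs.
From mathcomp Require Import all_boot all_order all_algebra.
From mathcomp Require Import all_classical all_reals all_analysis.
From mathcomp Require Import measurable_realfun ess_sup_inf.
From mathcomp Require Import ring lra.

Set Implicit Arguments.
Unset Strict Implicit.
Unset Printing Implicit Defensive.

Import Order.TTheory GRing.Theory Num.Theory.

Local Open Scope classical_set_scope.
Local Open Scope ring_scope.
Local Open Scope ereal_scope.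

(** * Vitali covering and countability of disjoint families *)

(** Zorn's lemma replaces the greedy choice of almost largest balls. Every ball meets a selected one
    of at least half its radius, and the factor 5 is then [r y + 2 * r x <= 5 * r y]. *)
Lemma vitali_covering (R : realType) (X : pseudoMetricType R) (V : set X)
    (r : X -> R) (M : R) :
  (forall x, V x -> 0 < r x <= M)%R ->
  exists D : set X, [/\ D `<=` V, trivIset D (fun x => ball x (r x)) &
    forall x, V x -> exists2 y, D y & ball x (r x) `<=` ball y (5 * r y)%R].
Proof.
move=> rM.
pose meets x y := ball x (r x) `&` ball y (r y) !=set0.
have meetsC x y : meets x y -> meets y x by rewrite /meets setIC.
(* By the last clause, a maximal D has, for every ball of V, a member which meets
   it and has at least half its radius. *)
pose P (D : set X) := [/\ D `<=` V, trivIset D (fun x => ball x (r x)) &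
  forall x y, V x -> D y -> meets x y ->
    exists z, [/\ D z, meets x z & (r x <= 2 * r z)%R]].
have [F FP Ftot|D [[DV Dtriv DP] Dmax]] := @Zorn_bigcup X P.
  split.
  - by move=> x [D /FP[DV _ _] /DV].
  - move=> x y [D1 FD1 D1x] [D2 FD2 D2y] xy.
    have [D12|D21] := Ftot _ _ FD1 FD2.
      by have [_ + _] := FP _ FD2; apply => //; exact: D12.
    by have [_ + _] := FP _ FD1; apply => //; exact: D21.
  - move=> x y Vx [D FD Dy] xy.
    have [_ _ /(_ _ _ Vx Dy xy)[z [Dz xz rxz]]] := FP _ FD.
    by exists z; split=> //; exists D.
have hit x : V x -> exists2 y, D y & meets x y.
  move=> Vx; apply: contrapT => xD.
  (* Among the balls that miss [D], one whose radius exceeds half the supremum of their radii can be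
     adjoined to [D] without losing [P], against maximality. *)
  pose W := [set z | V z /\ forall y, D y -> ~ meets z y].
  have Wx : W x by split=> // y Dy xy; apply: xD; exists y.
  have Wsup : has_sup (r @` W).
    split; first by exists (r x), x.
    by exists M => _ [z [Vz _] <-]; have /andP[] := rM _ Vz.
  have r0 : (0 < sup (r @` W))%R.
    have /andP[rx0 _] := rM _ Vx.
    by apply: (lt_le_trans rx0); apply: ub_le_sup; [exact: Wsup.2|exists x].
  have [|_ [z Wz <-] rz] := @sup_adherent _ _ (sup (r @` W) / 2)%R _ Wsup.
    by rewrite divr_gt0.
  have Vz := Wz.1.
  have rz0 : (0 < r z)%R by have /andP[] := rM _ Vz.
  have zz : meets z z by exists z; split; exact: ballxx.
  apply: (Dmax (z |` D)).
    split; first by move=> y; right.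
    by move=> /(_ z (or_introl erefl)) Dz; exact: Wz.2 zz.
  split.
  - by move=> y [->//|]; exact: DV.
  - move=> u v [->|Du] [->|Dv] // uv.
    + by have := Wz.2 _ Dv uv.
    + by have := Wz.2 _ Du (meetsC _ _ uv).
    + exact: Dtriv.
  - move=> u v Vu zDv uv.
    have [[w Dw uw]|uD] := pselect (exists2 w, D w & meets u w).
      have [y [Dy uy ruy]] := DP _ _ Vu Dw uw.
      by exists y; split=> //; right.
    have Wu : W u by split=> // w Dw uw; apply: uD; exists w.
    case: zDv uv => [-> uz|Dv uv]; last by case: uD; exists v.
    exists z; split=> //; first by left.
    have : (r u <= sup (r @` W))%R.
      by apply: ub_le_sup; [exact: Wsup.2|exists u].
    by move: rz; lra.
exists D; split=> // x Vx.
have [y0 Dy0 xy0] := hit x Vx.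
have [y [Dy [u [xu yu]] rxy]] := DP _ _ Vx Dy0 xy0.
exists y => // v xv; apply: (@le_ball _ _ _ (r y + (r x + r x))%R).
  by move: rxy; lra.
apply: (ball_triangle yu); apply: ball_triangle xv; exact: ball_sym.
Qed.

(** Disjointness leaves room in [E] for only finitely many sets of measure above [1 / (n + 1)], and
    [D] is the union over [n] of these finite index sets. *)
Lemma countable_trivIset_measure_gt0 d (T : measurableType d) (R : realType)
    (m : {measure set T -> \bar R}) (J : pointedType) (D : set J)
    (F : J -> set T) (E : set T) :
  measurable E -> m E < +oo -> (forall i, D i -> F i `<=` E) ->
  (forall i, D i -> measurable (F i)) -> (forall i, D i -> 0 < m (F i)) ->
  trivIset D F -> countable D.
Proof.
move=> mE Eoo FE mF F0 tF.
rewrite [X in countable X](_ : _ =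
    \bigcup_n [set i | D i /\ n.+1%:R^-1%:E < m (F i)]); last first.
  apply/seteqP; split=> [i Di|i [n _] []//].
  have Foo : m (F i) < +oo.
    rewrite (le_lt_trans _ Eoo)// le_measure ?inE//; [exact: mF|exact: FE].
  have Ffin : m (F i) \is a fin_num by rewrite ge0_fin_numE.
  have : (0 < fine (m (F i)))%R by rewrite fine_gt0// F0.
  move=> /ltr_add_invr[k]; rewrite add0r => kF; exists k => //; split=> //.
  by rewrite -(fineK Ffin) lte_fin.
apply: bigcup_countable => // n _; apply: finite_set_countable.
apply: contrapT => /infiniteP/pcard_leP/injfunPex[/= q q_fun q_inj].
have Dq k : D (q k) by have [] := q_fun k Logic.I.
have tq : trivIset setT (F \o q).
  move=> i j _ _ ij; apply: q_inj; rewrite ?inE//; exact: tF.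
have : m (\bigcup_k F (q k)) <= m E.
  rewrite le_measure ?inE//; last by apply: bigcup_sub => k _; exact: FE.
  by apply: bigcup_measurable => k _; exact: mF.
rewrite leNgt => /negP; apply.
rewrite measure_bigcup//; last by move=> k _; exact: mF.
have Efin : m E \is a fin_num by rewrite ge0_fin_numE.
(* [N] disjoint sets of measure above [1 / (n + 1)] already weigh more than [m E]. *)
pose N := (Num.truncn (fine (m E) * n.+1%:R)).+1.
apply: (@lt_le_trans _ _ (\sum_(0 <= k < N) n.+1%:R^-1%:E)); last first.
  rewrite (_ : \sum_(i <oo | i \in [set: nat]) m (F (q i)) =
    \sum_(0 <= i <oo) m (F (q i))); last by apply: eq_eseriesl => i; rewrite in_setT.
  apply: le_trans (nneseries_lim_ge N _) => //.
  by apply: lee_sum => k _; have [_ /ltW] := q_fun k Logic.I.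
rewrite sumEFin sumr_const_nat subn0 -{1}(fineK Efin) lte_fin.
rewrite -[ltRHS]mulr_natl ltr_pdivlMr//.
by apply: truncnS_gt.
Qed.

(** * Balls in a metric space *)

Section metric_balls.
Context (R : realType) (X : metricType R).
Implicit Types (x y : X) (r : R).

Lemma metric_ball_gt0 x y r : ball x r y -> (0 < r)%R.
Proof. by rewrite ballEmdist /=; apply: le_lt_trans; exact: mdist_ge0. Qed.

Lemma metric_ball_open x r : open (ball x r).
Proof.
rewrite openE => y; rewrite ballEmdist /= => xy.
apply/nbhs_ballP; exists (r - mdist x y)%R; first by rewrite /= subr_gt0.
move=> z; rewrite ballEmdist /= => yz.
by rewrite (le_lt_trans (metric_triangle x y z))// -ltrBrDl.
Qed.

End metric_balls.

(** * Total boundedness of [Omega] from doubling *)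

Section restricted_doubling.
Context (R : realType) (X : completeMetricType R).
Context (mu : {outer_measure set X -> \bar R}) (Omega : set X).
Hypothesis mu_regular : borel_regular mu.
Hypothesis openOmega : open Omega.
Hypothesis mu_ball_Omega : forall (x : X) (r : R), closure Omega x ->
  (0 < r)%R -> 0 < mu (ball x r `&` Omega) < +oo.
Hypothesis mu_doubling : restricted_doubling mu Omega.
Hypothesis bndOmega : metric_bounded Omega.

Lemma open_cara_measurable (A : set X) : open A ->
  measurable (A : set (caratheodory_type mu)).
Proof. by move=> oA; apply: (mu_regular.1); exact: sub_gen_smallest. Qed.

Lemma ball_cara_measurable (x : X) (r : R) :
  measurable (ball x r `&` Omega : set (caratheodory_type mu)).
Proof.
apply: measurableI; apply: open_cara_measurable => //.
exact: metric_ball_open.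
Qed.

Lemma doubling_iter (n : nat) : exists2 C : R, (0 < C)%R &
  forall (x : X) (r : R), closure Omega x -> (0 < r)%R ->
    mu (ball x (2 ^+ n * r)%R `&` Omega) <= C%:E * mu (ball x r `&` Omega).
Proof.
have [C C1 muC] := mu_doubling.
exists (C ^+ n)%R; first by rewrite exprn_gt0// (lt_le_trans _ C1).
elim: n => [|n IH] x r Ox r0; first by rewrite !expr0 mul1r mul1e.
rewrite exprS -mulrA (le_trans (muC _ _ _ _))//.
  by rewrite mulr_gt0 ?exprn_gt0.
by rewrite exprS EFinM -muleA lee_pmul2l ?IH// lte_fin (lt_le_trans _ C1).
Qed.

(** Finiteness is given for centres in the closure, so [Omega] is enclosed in a ball around one of
    its own points. *)
Lemma mu_Omega_lt_pinfty : mu Omega < +oo.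
Proof.
have [->|/set0P[x Ox]] := eqVneq Omega set0; first by rewrite outer_measure0.
have [y [r Or]] := bndOmega.
have r0 : (0 < r)%R by exact: metric_ball_gt0 (Or _ Ox).
have [] := andP (@mu_ball_Omega x (r + r)%R (subset_closure Ox) _).
  by rewrite addr_gt0.
move=> _; apply: le_lt_trans; apply: le_outer_measure => z Oz; split=> //.
apply: ball_triangle (Or _ Oz); apply: ball_sym; exact: Or.
Qed.

(** A number of doublings independent of the centre makes the ball swallow [Omega]; the bound is
    thus [mu Omega] over the iterated doubling constant. *)
Lemma mu_ball_lower_bound (r : R) : Omega !=set0 -> (0 < r)%R ->
  exists2 c : R, (0 < c)%R &
    forall x, closure Omega x -> c%:E <= mu (ball x r `&` Omega).
Proof.
move=> [x0 Ox0] r0; have [y [s Os]] := bndOmega.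
have s0 : (0 < s)%R by exact: metric_ball_gt0 (Os _ Ox0).
(* Three steps of length [s] lead from [x] to a nearby point of [Omega], to the centre [y], and to
   an arbitrary point of [Omega]. *)
have [n ns] : exists n : nat, (s + s + s < 2 ^+ n * r)%R.
  exists (Num.truncn ((s + s + s) / r)).+1.
  rewrite -ltr_pdivrMr//; apply: (lt_trans (truncnS_gt _)).
  by rewrite -natrX ltr_nat ltn_expl.
have [C C0 muC] := doubling_iter n.
have Ooo := mu_Omega_lt_pinfty.
have Ofin : mu Omega \is a fin_num by rewrite ge0_fin_numE.
have O0 : (0 < fine (mu Omega))%R.
  rewrite fine_gt0// Ooo andbT.
  have /andP[+ _] := @mu_ball_Omega x0 1%R (subset_closure Ox0) ltr01.
  by move/lt_le_trans; apply; apply: le_outer_measure; exact: subIsetr.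
exists (fine (mu Omega) / C)%R; first by rewrite divr_gt0.
move=> x Ox; rewrite EFinM muleC -lee_pdivlMl ?invr_gt0// invrK fineK//.
apply: le_trans (muC _ _ Ox r0); apply: le_outer_measure => z Oz; split=> //.
apply: (le_ball (ltW ns)).
have [w [Ow xw]] := Ox _ (nbhsx_ballx x s s0).
apply: ball_triangle (Os _ Oz); apply: (ball_triangle xw).
by apply: ball_sym; exact: Os.
Qed.

(** Without a finite net, points at mutual distance at least [r] can be added forever. The balls of
    radius [r / 2] around them are disjoint and each carries mass at least [c], which exhausts
    [mu Omega]. *)
Lemma finite_net (r : R) : Omega !=set0 -> (0 < r)%R -> exists s : seq X,
  (forall x, x \in s -> Omega x) /\
  forall y, Omega y -> exists2 x, x \in s & ball x r y.
Proof.
move=> O0 r0; apply: contrapT => nonet.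
have r20 : (0 < r / 2)%R by rewrite divr_gt0.
have [c c0 muc] := mu_ball_lower_bound O0 r20.
have Ooo := mu_Omega_lt_pinfty.
have Ofin : mu Omega \is a fin_num by rewrite ge0_fin_numE.
pose U (s : seq X) := \big[setU/set0]_(x <- s) (ball x (r / 2) `&` Omega).
have mU s : measurable (U s : set (caratheodory_type mu)).
  by apply: bigsetU_measurable => x _; exact: ball_cara_measurable.
have many n : exists s : seq X, (forall x, x \in s -> Omega x) /\
    (n%:R * c)%:E <= mu (U s).
  elim: n => [|n [s [sO sU]]].
    by exists nil; split=> //; rewrite mul0r /U big_nil outer_measure0.
  have [y [Oy ys]] : exists y, Omega y /\ forall x, x \in s -> ~ ball x r y.
    apply: contrapT => noy; apply: nonet; exists s; split=> // y Oy.
    apply: contrapT => ys; apply: noy; exists y; split=> // x xs xy.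
    by apply: ys; exists x.
  exists (y :: s); split=> [x|]; first by rewrite inE => /predU1P[->//|/sO].
  rewrite /U big_cons -/(U s).
  rewrite [leRHS](@measureU _ _ _ (cara_measure mu))//; last first.
    apply/eqP/negPn/negP => /set0P[z [[yz _]]].
    rewrite /U -bigcup_seq => -[x /= xs [xz _]].
    apply: (ys x xs); rewrite (splitr r).
    by apply: (ball_triangle xz); exact: ball_sym.
  - exact: ball_cara_measurable.
  rewrite -nat1r mulrDl mul1r EFinD; apply: leeD => //.
  by apply: muc; exact: subset_closure.
pose N := (Num.truncn (fine (mu Omega) / c)).+1.
have [s [_ sU]] := many N.
have : (N%:R * c)%:E <= mu Omega.
  apply: (le_trans sU); apply: le_outer_measure.
  by rewrite /U -bigcup_seq; apply: bigcup_sub => x _; exact: subIsetr.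
rewrite -(fineK Ofin) lee_fin -ler_pdivlMr// leNgt => /negP; apply.
exact: truncnS_gt.
Qed.

End restricted_doubling.

(** * From local to global comparability *)

Section global_comparability.
Context (R : realType) (X : completeMetricType R).
Context (mu : {outer_measure set X -> \bar R}) (Omega : set X).
Hypothesis mu_regular : borel_regular mu.
Hypothesis openOmega : open Omega.
Hypothesis mu_ball_Omega : forall (x : X) (r : R), closure Omega x ->
  (0 < r)%R -> 0 < mu (ball x r `&` Omega) < +oo.
Hypothesis mu_doubling : restricted_doubling mu Omega.
Hypothesis bndOmega : metric_bounded Omega.
Hypothesis connectedOmega : connected Omega.
Variable H : X -> \bar R -> \bar R.
Hypothesis H_ge0 : forall x xi, closure Omega x -> 0 <= xi -> 0 <= H x xi.
Hypothesis le_H : forall x xi eta, closure Omega x -> 0 <= xi -> xi <= eta ->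
  H x xi <= H x eta.

Let cmp (K : R) (x y : X) := forall xi : R, (0 <= xi)%R ->
  H x xi%:E <= K%:E * H y (K * xi)%:E.

Let cmp_trans (K L : R) x y z : (0 <= K)%R -> (0 <= L)%R ->
  cmp K x y -> cmp L y z -> cmp (K * L) x z.
Proof.
move=> K0 L0 xy yz xi xi0; apply: (le_trans (xy _ xi0)).
rewrite [(K * L)%:E]EFinM -muleA lee_wpmul2l ?lee_fin// [(K * L)%R]mulrC -mulrA.
by apply: yz; rewrite mulr_ge0.
Qed.

Let cmp_weaken (K L : R) x y : (0 <= K)%R -> (K <= L)%R ->
  closure Omega y -> cmp K x y -> cmp L x y.
Proof.
move=> K0 KL Oy xy xi xi0; apply: (le_trans (xy _ xi0)).
apply: lee_pmul; rewrite ?lee_fin//.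
  by apply: H_ge0 => //; rewrite lee_fin mulr_ge0.
by apply: le_H => //; rewrite lee_fin ?mulr_ge0// ler_wpM2r.
Qed.

(** Connectedness makes every point of [Omega] comparable with [x0], with a constant depending on
    the point. A finite net makes the constant uniform, and one more local comparison reaches the
    closure. *)
Lemma global_comparability x0 : local_comparability H (closure Omega) ->
  Omega x0 -> exists2 K : R, (1 <= K)%R & forall x, closure Omega x ->
    forall xi : R, (0 <= xi)%R ->
      H x xi%:E <= K%:E * H x0 (K * xi)%:E /\
      H x0 xi%:E <= K%:E * H x (K * xi)%:E.
Proof.
move=> [C [R0 [C1 R00 loc]]] Ox0.
have C0 : (0 <= C)%R by apply: le_trans C1.
pose r := (R0 / 2)%R.
have r0 : (0 < r)%R by rewrite divr_gt0.
have rR0 : (0 < r < R0)%R by rewrite r0/= ltr_pdivrMr// mulr_natr mulr2n ltrDl.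
have near x y : closure Omega x -> closure Omega y -> ball x r y ->
    cmp C x y /\ cmp C y x.
  move=> Ox Oy xy; split=> xi xi0.
    by apply: (loc x r) => //; split=> //; exact: ballxx.
  by apply: (loc x r) => //; split=> //; exact: ballxx.
pose S := [set y | Omega y /\
  exists2 K : R, (1 <= K)%R & cmp K x0 y /\ cmp K y x0].
have step x y : S x -> Omega y -> ball x r y -> S y.
  move=> [Ox [K K1 [Kx0 Kx]]] Oy xy; split=> //.
  have K0 : (0 <= K)%R by apply: le_trans K1.
  have [xyC yxC] := near _ _ (subset_closure Ox) (subset_closure Oy) xy.
  exists (K * C)%R; first by rewrite (le_trans K1)// ler_peMr.
  by split; [exact: cmp_trans xyC|rewrite mulrC; exact: cmp_trans Kx].
(* By [step], [S] contains every point of [Omega] within [r] of it, so it is both relatively open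
   and relatively closed. *)
have SO : S = Omega.
  apply: connectedOmega.
  - exists x0; split=> //; exists 1%R => //.
    by split=> xi xi0; rewrite mul1e mul1r.
  - exists (\bigcup_(x in S) ball x r).
      by apply: bigcup_open => x _; exact: metric_ball_open.
    apply/seteqP; split=> [y Sy|y [Oy [x Sx xy]]]; last exact: step xy.
    by split; [exact: Sy.1|exists y => //; exact: ballxx].
  - exists (closure S); first exact: closed_closure.
    apply/seteqP; split=> [y Sy|y [Oy /(_ _ (nbhsx_ballx y r r0))[x [Sx yx]]]].
      by split; [exact: Sy.1|exact: subset_closure].
    exact: step (ball_sym yx).
(* The radius [r / 2] leaves room for a second step of length [r / 2] from [Omega] to a point of its
   closure. *)
have [s [sO s_net]] : exists s : seq X, (forall x, x \in s -> Omega x) /\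
    forall y, Omega y -> exists2 x, x \in s & ball x (r / 2) y.
  by apply: (finite_net mu_regular) => //; [exists x0|rewrite divr_gt0].
have [K K1 sK] : exists2 K : R, (1 <= K)%R &
    forall x, x \in s -> cmp K x0 x /\ cmp K x x0.
  elim: s sO {s_net} => [|x s IH] sO; first by exists 1%R.
  have [|K K1 sK] := IH; first by move=> y ys; apply: sO; rewrite inE ys orbT.
  have Ox : Omega x by apply: sO; rewrite inE eqxx.
  have [_ [L L1 [Lx0 Lx]]] : S x by rewrite SO.
  have Ox0' := subset_closure Ox0.
  (* The sum serves as a common upper bound of the two constants. *)
  exists (K + L)%R; first by rewrite (le_trans K1)// lerDl (le_trans _ L1).
  have K0 : (0 <= K)%R by rewrite (le_trans _ K1).
  have L0 : (0 <= L)%R by rewrite (le_trans _ L1).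
  have Ky y : y \in s -> closure Omega y.
    by move=> ys; apply: subset_closure; apply: sO; rewrite inE ys orbT.
  move=> y; rewrite inE => /predU1P[->|ys].
    by split; apply: (@cmp_weaken L) => //; rewrite ?lerDr//; exact: subset_closure.
  have [? ?] := sK y ys.
  by split; apply: (@cmp_weaken K) => //; rewrite ?lerDl//; exact: Ky.
have K0 : (0 <= K)%R by rewrite (le_trans _ K1).
exists (K * C)%R; first by rewrite (le_trans K1)// ler_peMr.
move=> x Ox xi xi0.
have r20 : (0 < r / 2)%R by rewrite divr_gt0.
have [y [Oy xy]] := Ox _ (nbhsx_ballx x (r / 2)%R r20).
have [z zs zy] := s_net y Oy.
have zx : ball z r x.
  by rewrite (splitr r); apply: (ball_triangle zy); exact: ball_sym.
have [zxC xzC] := near _ _ (subset_closure (sO _ zs)) Ox zx.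
have [Kz0 Kz] := sK z zs.
split; first by rewrite mulrC; exact: (cmp_trans C0 K0 xzC Kz).
exact: (cmp_trans K0 C0 Kz0 zxC).
Qed.

End global_comparability.

(** * Dyadic decomposition of powers *)

Section dyadic_layers.
Context (R : realType).
Implicit Types (a r p s K v : R) (n j : nat).

Lemma powR_gt1 a r : (1 < a)%R -> (0 < r)%R -> (1 < a `^ r)%R.
Proof.
move=> a1 r0; have := gt0_ltr_powR r0 _ _ a1; rewrite powR1; apply.
  by rewrite nnegrE.
by rewrite nnegrE (le_trans _ (ltW a1)).
Qed.

(** The nonzero terms form a geometric progression of ratio [b = 2 ^ (p - 1) > 1], so their sum is
    at most [b / (b - 1)] times the last one, which is below [v ^ (p - 1)]. *)
Lemma dyadic_level_sum_le p s v n : (1 < p)%R -> (0 < s)%R -> (0 <= v)%R ->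
  (\sum_(0 <= j < n) (2 ^+ j * s) `^ (p - 1) * (2 ^+ j * s < v)%R%:R <=
    2 `^ (p - 1) / (2 `^ (p - 1) - 1) * v `^ (p - 1))%R.
Proof.
move=> p1 s0 v0; set b := (2 `^ (p - 1))%R.
have b1 : (1 < b)%R.
  by rewrite powR_gt1 ?ltr1n ?subr_gt0.
have b0 : (0 < b - 1)%R by rewrite subr_gt0.
pose A j := ((2 ^+ j * s) `^ (p - 1))%R.
have AS j : (A j.+1 = b * A j)%R.
  by rewrite /A exprS -mulrA powRM// mulr_ge0 ?exprn_ge0 ?(ltW s0).
have A0 j : (0 <= A j)%R by exact: powR_ge0.
(* Both bounds are needed: the first one, uniform in v, drives the induction. *)
suff /andP[] : ((\sum_(0 <= j < n) A j * (2 ^+ j * s < v)%R%:R <= A n / (b - 1)) &&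
   (\sum_(0 <= j < n) A j * (2 ^+ j * s < v)%R%:R <= b / (b - 1) * v `^ (p - 1)))%R.
  by [].
elim: n => [|n /andP[IH1 IH2]].
  rewrite big_geq// divr_ge0 ?(ltW b0)//= mulr_ge0 ?powR_ge0// divr_ge0 ?(ltW b0)//.
  by rewrite (le_trans _ (ltW b1)).
rewrite big_nat_recr//=.
have S1 : (\sum_(0 <= j < n) A j * (2 ^+ j * s < v)%R%:R + A n <= A n.+1 / (b - 1))%R.
  rewrite AS (_ : b * A n / (b - 1) = A n / (b - 1) + A n)%R ?lerD2r//.
  by field; rewrite gt_eqF.
have [nv|nv] := ltP (2 ^+ n * s)%R v; rewrite ?mulr1 ?mulr0 ?addr0.
  rewrite S1/= (le_trans S1)// AS mulrAC ler_wpM2l//.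
    by rewrite divr_ge0 ?(ltW b0)// (le_trans _ (ltW b1)).
  rewrite ge0_ler_powR ?nnegrE ?subr_ge0 ?(ltW p1)//; last exact: ltW.
  by rewrite mulr_ge0 ?exprn_ge0 ?(ltW s0).
by rewrite IH2 andbT (le_trans _ S1)// lerDl.
Qed.

(** Applied pointwise to [x = |g|], this sums the truncations produced by the weak type estimate.
    Replacing [s] by [s / K] in the previous bound costs the factor [K ^ (p - 1)]. *)
Lemma dyadic_layer_sum_le p K : (1 < p)%R -> (0 < K)%R ->
  exists2 C : R, (0 < C)%R & forall s, (0 < s)%R -> forall x : \bar R, 0 <= x ->
    \sum_(0 <= j <oo) ((2 ^+ j * s) `^ (p - 1))%:E *
      (if (2 ^+ j * s / K)%:E < x then x else 0) <= C%:E * x `^ p.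
Proof.
move=> p1 K0; set b := (2 `^ (p - 1))%R.
have b1 : (1 < b)%R.
  by rewrite powR_gt1 ?ltr1n ?subr_gt0.
have b0 : (0 < b - 1)%R by rewrite subr_gt0.
have C0 : (0 < K `^ (p - 1) * (b / (b - 1)))%R.
  by rewrite mulr_gt0 ?powR_gt0// divr_gt0// (lt_trans _ b1).
exists (K `^ (p - 1) * (b / (b - 1)))%R => // s s0 [v|_|//]; last first.
  by rewrite poweRyr ?gt_eqF ?(lt_trans _ p1)// gt0_muley ?lte_fin// leey.
rewrite lee_fin => v0.
apply: lime_le.
  apply: is_cvg_nneseries => j _ _; apply: mule_ge0.
    by rewrite lee_fin powR_ge0.
  by case: ifPn.
near=> n.
have := dyadic_level_sum_le n p1 (divr_gt0 s0 K0) v0.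
move=> /(ler_wpM2l (mulr_ge0 (powR_ge0 K (p - 1)) v0)).
rewrite mulr_sumr -lee_fin -sumEFin => /le_trans le; apply: le_trans (le _ _).
  apply: lee_sum => j _; rewrite lte_fin -[(2 ^+ j * s / K)%R]mulrA.
  have [_|_] := ltP (2 ^+ j * (s / K))%R v; last by rewrite mule0 !mulr0.
  rewrite -EFinM mulr1 lee_fin mulrAC -powRM ?(ltW K0)//; last first.
    by rewrite mulr_ge0 ?exprn_ge0// divr_ge0 ?(ltW s0) ?(ltW K0).
  rewrite (_ : K * (2 ^+ j * (s / K)) = 2 ^+ j * s)%R//.
  by field; rewrite gt_eqF.
rewrite lee_fin (_ : v `^ p = v * v `^ (p - 1))%R; last first.
  by rewrite mulr_powRB1// (lt_trans _ p1).
by rewrite -/b le_eqVlt; apply/orP; left; apply/eqP; field; rewrite gt_eqF.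
Unshelve. all: by end_near. Qed.

(** A value between two consecutive levels is controlled by the layer of the lower one, whose weight
    is the [p]-th power of the upper one; values up to [s] are absorbed by [s ^ p]. *)
Lemma poweR_le_dyadic_layers p s (x : \bar R) : (1 < p)%R -> (0 < s)%R -> 0 <= x ->
  x `^ p <= (s `^ p)%:E + \sum_(0 <= j <oo)
    ((2 * (2 ^+ j * s)) `^ p)%:E * (if (2 ^+ j * s)%:E < x then 1 else 0).
Proof.
move=> p1 s0; have p0 : (0 <= p)%R by rewrite (le_trans _ (ltW p1)).
have term_ge0 (y : \bar R) j : 0 <= ((2 * (2 ^+ j * s)) `^ p)%:E *
    (if (2 ^+ j * s)%:E < y then 1 else 0).
  by rewrite mule_ge0 ?lee_fin ?powR_ge0//; case: ifPn.
(* Working with real [v] below [x] also covers [x = +oo], where the right-hand side then exceeds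
   every real number. *)
have real v : (0 <= v)%R -> v%:E <= x -> (v `^ p)%:E <= (s `^ p)%:E +
    \sum_(0 <= j <oo) ((2 * (2 ^+ j * s)) `^ p)%:E *
      (if (2 ^+ j * s)%:E < x then 1 else 0).
  move=> v0 vx; have [vs|sv] := leP v s.
    rewrite -[leLHS]adde0; apply: leeD.
      by rewrite lee_fin ge0_ler_powR ?nnegrE// ltW.
    by apply: nneseries_ge0 => j _ _.
  have : exists j, (v <= 2 ^+ j * s)%R.
    exists (Num.truncn (v / s)).+1; rewrite -ler_pdivrMr//.
    apply: ltW; apply: (lt_trans (truncnS_gt _)).
    by rewrite -natrX ltr_nat ltn_expl.
  (* The least index is positive because [s < v]; its predecessor [j] satisfies
     [2 ^ j * s < v <= 2 ^ (j + 1) * s]. *)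
  move=> /ex_minnP[[|j] vj minj]; first by move: vj; rewrite expr0 mul1r leNgt sv.
  have jv : (2 ^+ j * s < v)%R.
    by rewrite ltNge; apply/negP => /minj; rewrite ltnn.
  rewrite -[leLHS]add0e; apply: leeD; first by rewrite lee_fin powR_ge0.
  apply: le_trans (nneseries_lim_ge j.+1 _); last by move=> *; exact: term_ge0.
  rewrite big_nat_recr//= -[leLHS]add0e; apply: leeD.
    by apply: sume_ge0 => *; exact: term_ge0.
  rewrite (lt_le_trans _ vx) ?lte_fin// mule1 lee_fin.
  rewrite ge0_ler_powR ?nnegrE//; last by rewrite mulrA -exprS.
  by rewrite !mulr_ge0 ?exprn_ge0// ltW.
case: x real => [v|real _|//]; first by move=> real v0; exact: real.
rewrite poweRyr ?gt_eqF ?(lt_trans _ p1)// leye_eq; apply/eqP/eqyP => A A0.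
(* The shift by 1 puts the base above 1, so that [(1 + A) ^ p >= 1 + A >= A]. *)
apply: (@le_trans _ _ ((1 + A) `^ p)%:E); last first.
  by apply: real; rewrite ?leey// addr_ge0// ltW.
rewrite lee_fin (@le_trans _ _ (1 + A)%R)// ?lerDr//.
by rewrite -[leLHS]powRr1 ?addr_ge0 ?(ltW A0)// ler_powR ?(ltW p1)// lerDl ltW.
Qed.

End dyadic_layers.

(** * Weak type estimate for the fractional maximal operator *)

Section frac_maximal.
Context (R : realType) (X : completeMetricType R).
Context (mu nu : {outer_measure set X -> \bar R}).
Context (Omega : set X) (theta : R).
Hypothesis mu_regular : borel_regular mu.
Hypothesis nu_regular : borel_regular nu.
Hypothesis openOmega : open Omega.
Hypothesis mu_ball_Omega : forall (x : X) (r : R), closure Omega x ->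
  (0 < r)%R -> 0 < mu (ball x r `&` Omega) < +oo.
Hypothesis mu_doubling : restricted_doubling mu Omega.
Hypothesis bndOmega : metric_bounded Omega.
Hypothesis theta_ge0 : (0 <= theta)%R.
Hypothesis nu_codim : upper_codimension mu nu Omega theta.

Local Notation m := (cara_measure mu).
Local Notation M := (frac_maximal mu Omega theta).

Lemma boundary_closure : boundary Omega `<=` closure Omega.
Proof. by move=> x []. Qed.

(** The bound on the admissible radii serves twice: it allows the Vitali covering and it fixes the
    truncation height in the weak type estimate. *)
Lemma diam_boundary_lt : exists2 D : R, (0 < D)%R &
  forall r : R, r%:E < 2%:E * diam (boundary Omega) -> (r < D)%R.
Proof.
have [y [s Os]] := bndOmega.
(* The maximum keeps the radius positive even if [Omega] is empty; the added 1 reaches the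
   closure. *)
pose s' := (Num.max s 1 + 1)%R.
have s0 : (0 < s')%R by rewrite addr_gt0// lt_max ltr01 orbT.
have Oball x : boundary Omega x -> ball y s' x.
  move=> [/(_ _ (nbhsx_ballx x 1%R ltr01))[z [Oz xz]] _].
  apply: ball_triangle (ball_sym xz).
  by apply: le_ball (Os _ Oz); rewrite le_max lexx.
exists (2 * (s' + s'))%R; first by rewrite mulr_gt0// addr_gt0.
move=> r /lt_le_trans rdiam; rewrite -lte_fin; apply: rdiam.
rewrite EFinM lee_pmul2l// /diam; apply: ge_ereal_sup => _ [x bx [z bz <-]].
rewrite lee_fin; apply: ltW.
have : ball x (s' + s')%R z.
  by apply: ball_triangle (Oball _ bz); apply: ball_sym; exact: Oball.
by rewrite ballEmdist.
Qed.

(** The factor 5 is that of the Vitali covering. Three doublings suffice since [5 <= 2 ^ 3], and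
    [theta >= 0] lets the power of [5 * r] be replaced by that of [r]. *)
Lemma codim_dilated_ball : exists2 C : R, (0 < C)%R &
  forall (z : X) (r : R), boundary Omega z -> (0 < r)%R ->
    nu (ball z (5 * r)%R `&` boundary Omega) <=
      C%:E * ((r `^ (- theta))%:E * mu (ball z r `&` Omega)).
Proof.
have [C1 C10 nuC] := nu_codim.
have [C2 C20 muC] := doubling_iter mu_doubling 3.
exists (C1 * C2)%R; first by rewrite mulr_gt0.
move=> z r bz r0; have r50 : (0 < 5 * r)%R by rewrite mulr_gt0.
apply: (le_trans (nuC _ _ bz r50)).
rewrite EFinM -!muleA lee_pmul2l//.
rewrite (muleCA C2%:E); apply: lee_pmul.
- by rewrite lee_fin powR_ge0.
- exact: outer_measure_ge0.
- rewrite lee_fin !powRN lef_pV2 ?posrE ?powR_gt0//.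
  by rewrite ge0_ler_powR ?nnegrE ?(ltW r0)// ?(ltW r50)// ler_peMl ?(ltW r0)// ler1n.
- apply: (le_trans _ (muC _ _ (boundary_closure bz) r0)).
  apply: le_outer_measure => x [xz Ox]; split=> //.
  by apply: le_ball xz; rewrite ler_wpM2r ?(ltW r0)// -natrX ler_nat.
Qed.

(** Since [r < D], the part of [g] below [t / K] contributes at most [r ^ theta * t / K <= t / 2] to
    an average. Where [M g > t], the part above must supply the other half, and a disjoint family of
    such balls sums these contributions. *)
Lemma frac_maximal_weak : exists C K : R, [/\ (0 < C)%R, (0 < K)%R &
  forall (g : X -> \bar R) (t : R),
    measurable_fun (Omega : set (caratheodory_type mu)) g -> (0 < t)%R ->
    nu [set z | boundary Omega z /\ t%:E < M g z] <=
      (C / t)%:E * \int[m]_(x in Omega `&` [set x | (t / K)%:E < `|g x|])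
        `|g x|].
Proof.
have [D D0 diamD] := diam_boundary_lt.
have [C C0 nuC] := codim_dilated_ball.
have Dt0 : (0 < D `^ theta)%R by rewrite powR_gt0.
exists (C * 2)%R, (2 * D `^ theta)%R; split; rewrite ?mulr_gt0//.
move=> g t mg t0.
set K := (2 * D `^ theta)%R; set S := Omega `&` _.
have K0 : (0 < K)%R by rewrite mulr_gt0.
have mabs : measurable_fun (Omega : set (caratheodory_type mu)) (abse \o g).
  by apply: measurableT_comp => //; exact: abse_measurable.
have mO : measurable (Omega : set (caratheodory_type mu)).
  exact: open_cara_measurable.
have mS : measurable (S : set (caratheodory_type mu)).
  exact: (emeasurable_fun_o_infty mO mabs).
have SO : S `<=` Omega by exact: subIsetl.
pose J (z : X) (r : R) := \int[m]_(x in ball z r `&` S) `|g x|.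
have mB z r : measurable (ball z r `&` Omega : set (caratheodory_type mu)).
  exact: ball_cara_measurable.
have mBS z r : measurable (ball z r `&` S : set (caratheodory_type mu)).
  by apply: measurableI => //; apply: open_cara_measurable => //;
    exact: metric_ball_open.
have ex_radius z : boundary Omega z -> t%:E < M g z -> exists r, (0 < r < D)%R /\
    (r `^ (- theta))%:E * mu (ball z r `&` Omega) <= (2 / t)%:E * J z r.
  move=> bz; rewrite /frac_maximal lt_max [t%:E < 0]lte_fin (ltNge t) (ltW t0)/=.
  move=> /ereal_sup_gt[_ [r [r0 /diamD rD] <-]] tr.
  exists r; split; first by rewrite r0.
  have /andP[mur0 muroo] := mu_ball_Omega (boundary_closure bz) r0.
  have murfin : mu (ball z r `&` Omega) \is a fin_num by rewrite ge0_fin_numE ?ltW.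
  move: tr mur0; rewrite -(fineK murfin); set v := fine _.
  rewrite !lte_fin => tr v0.
  rewrite leNgt; apply/negP => JS.
  (* The negated inequality forces [J z r] to be finite, which permits real arithmetic. *)
  have [j Jj] : exists j : R, J z r = j%:E.
    exists (fine (J z r)); rewrite fineK// ge0_fin_numE; last exact: integral_ge0.
    rewrite ltey; apply: contraTneq JS => ->.
    by rewrite gt0_muley ?lte_fin ?divr_gt0// -leNgt leey.
  have Ileq : \int[m]_(x in ball z r `&` Omega) `|g x| <=
      J z r + (t / K * v)%:E.
    rewrite (_ : ball z r `&` Omega =
      (ball z r `&` S) `|` (ball z r `&` (Omega `\` S))); last first.
      by rewrite -setIUr setDUK.
    rewrite ge0_integral_setU//; last 3 first.
    - apply: measurableI; last exact: measurableD.
      by apply: open_cara_measurable => //; exact: metric_ball_open.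
    - by rewrite -setIUr setDUK//; apply: measurable_funS mabs => //.
    - by apply/disj_setPS => x [[_ Sx] [_ []]].
    rewrite leeD2l//.
    have mBD : measurable (ball z r `&` (Omega `\` S) : set (caratheodory_type mu)).
      apply: measurableI; last exact: measurableD.
      by apply: open_cara_measurable => //; exact: metric_ball_open.
    apply: (@le_trans _ _ (\int[m]_(x in ball z r `&` (Omega `\` S)) (t / K)%:E)).
      apply: ge0_le_integral => //.
      - by apply: measurable_funS mabs => // x [_ []].
      - by move=> x [_ [Ox]] /not_andP[//|/negP]; rewrite -leNgt.
    rewrite integral_cst//= [leRHS]EFinM lee_pmul2l ?lte_fin ?divr_gt0//.
    rewrite fineK//; apply: le_outer_measure; apply: setIS; exact: subDsetl.
  move: JS tr; rewrite Jj -!EFinM lte_fin => jv.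
  rewrite inver gt_eqF// => tr.
  have rt0 : (0 < r `^ theta)%R by rewrite powR_gt0.
  have : (t < r `^ theta * v^-1 * (j + t / K * v))%R.
    rewrite -lte_fin; apply: (lt_le_trans tr).
    rewrite -EFinM [leRHS]EFinM lee_wpmul2l//; last by rewrite EFinD -Jj.
    by rewrite lee_fin divr_ge0 ?(ltW v0) ?(ltW rt0).
  rewrite ltNge => /negP; apply; rewrite mulrDr.
  rewrite [leRHS]splitr; apply: lerD.
    have : (j < t / 2 * (r `^ (- theta) * v))%R.
      by rewrite -ltr_pdivrMl ?divr_gt0// invf_div.
    move/ltW/(ler_wpM2l (ltW (mulr_gt0 rt0 _))) => /(_ (v^-1)%R).
    rewrite invr_gt0 => /(_ v0)/le_trans; apply.
    rewrite powRN [leLHS](_ : _ = t / 2)%R//.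
    by field; rewrite !gt_eqF.
  rewrite [leLHS](_ : _ = r `^ theta * (t / K))%R; last by field; rewrite !gt_eqF.
  rewrite mulrA ler_pdivrMr// (_ : t / 2 * K = D `^ theta * t)%R; last first.
    by rewrite /K; field.
  rewrite ler_wpM2r ?(ltW t0)// ge0_ler_powR// ?nnegrE ?(ltW r0)// ltW//.
set E := [set z | _ /\ _].
pose rho z := if pselect (E z) is left Ez then
  sval (cid (ex_radius z Ez.1 Ez.2)) else 0%R.
have rhoP z : E z -> (0 < rho z <= D)%R /\
   ((rho z) `^ (- theta))%:E * mu (ball z (rho z) `&` Omega) <=
     (2 / t)%:E * J z (rho z).
  rewrite /rho; case: pselect => // Ez _; case: cid => r /= [/andP[r0 rD] rJ].
  by rewrite r0 ltW.
have [F [FE tF coverF]] := vitali_covering (fun z Ez => (rhoP z Ez).1).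
have rho_gt0 z : F z -> (0 < rho z)%R by move=> /FE/rhoP[/andP[]].
(* The selected balls meet [Omega] in disjoint sets of positive measure, so they can be
   enumerated. *)
have /countable_injP[idx idx_inj] : countable F.
  apply: (@countable_trivIset_measure_gt0 _ _ _ m _ F
    (fun z => ball z (rho z) `&` Omega) Omega) => //.
  - exact: mu_Omega_lt_pinfty.
  - move=> z Fz; have [bz _] := FE _ Fz.
    by have /andP[] := mu_ball_Omega (boundary_closure bz) (rho_gt0 _ Fz).
  - by move=> x y Fx Fy [u [[xu _] [yu _]]]; apply: tF => //; exists u.
(* Each fibre of [idx] is empty or a single centre, which turns the family into a sequence without a
   surjective enumeration. *)
pose Fn n := [set z | F z /\ idx z = n].
have Fn0 n : Fn n = set0 \/ exists2 z, F z & Fn n = [set z].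
  have [->|/set0P[z [Fz zn]]] := eqVneq (Fn n) set0; first by left.
  right; exists z => //; apply/seteqP; split=> [y [Fy yn]|_ ->//].
  by apply: idx_inj; rewrite ?inE// yn.
pose G n := \bigcup_(z in Fn n) (ball z (5 * rho z) `&` boundary Omega).
pose H n := \bigcup_(z in Fn n) (ball z (rho z) `&` S).
have nuGH n : nu (G n) <= (C * 2 / t)%:E * \int[m]_(x in H n) `|g x|.
  rewrite /G /H; have [->|[z Fz ->]] := Fn0 n.
    by rewrite !bigcup_set0 outer_measure0 integral_set0 mule0.
  rewrite !bigcup_set1; have [bz _] := FE _ Fz.
  apply: (le_trans (nuC _ _ bz (rho_gt0 _ Fz))).
  rewrite -mulrA EFinM -muleA lee_pmul2l//.
  by have [] := rhoP z (FE _ Fz).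
have mH n : measurable (H n : set (caratheodory_type mu)).
  rewrite /H; have [->|[z Fz ->]] := Fn0 n; first by rewrite bigcup_set0.
  by rewrite bigcup_set1.
have tH : trivIset setT H.
  move=> i j _ _ [x [[y [Fy yi] [yx _]] [z [Fz zj] [zx _]]]].
  by rewrite -yi -zj; congr idx; apply: tF => //; exists x.
have EG : E `<=` \bigcup_n G n.
  move=> z Ez; have [y Fy zy] := coverF z Ez.
  exists (idx y) => //; exists y => //; split; last exact: Ez.1.
  by apply: zy; apply: ballxx; have [/andP[]] := rhoP z Ez.
(* Monotonicity and subadditivity of the outer measure bound [nu E] without measurability of [E]. *)
apply: (le_trans (le_outer_measure nu _ _ EG)).
apply: (le_trans (outer_measure_sigma_subadditive nu G)).
apply: (@le_trans _ _ (\sum_(n <oo) ((C * 2 / t)%:E * \int[m]_(x in H n) `|g x|))).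
  by apply: lee_nneseries => // n _; exact: nuGH.
rewrite nneseriesZl; last by move=> n _; exact: integral_ge0.
rewrite lee_pmul2l// ?lte_fin ?divr_gt0 ?mulr_gt0//.
have HS : \bigcup_n H n `<=` S by move=> x [n _ [z _ []]].
rewrite -ge0_integral_bigcup//; last first.
  by apply: measurable_funS mabs => //; exact: subset_trans HS SO.
apply: ge0_subset_integral => //.
- exact: bigcup_measurable.
- exact: measurable_funS mabs.
Qed.

(** * From the weak to the strong type estimate *)

Lemma boundary_cara_measurable :
  measurable (boundary Omega : set (caratheodory_type nu)).
Proof.
apply: measurableD; last first.
  by apply: open_cara_measurable => //; exact: open_interior.
rewrite -[closure _]setCK; apply: measurableC.
by apply: open_cara_measurable => //; apply: closed_openC; exact: closed_closure.
Qed.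

Lemma nu_boundary_lt_pinfty : nu (boundary Omega) < +oo.
Proof.
have [->|/set0P[x bx]] := eqVneq (boundary Omega) set0.
  by rewrite outer_measure0.
have [C C0 nuC] := nu_codim; have [y [s Os]] := bndOmega.
have s0 : (0 < s)%R.
  have [z [Oz _]] := boundary_closure bx (nbhsx_ballx x 1%R ltr01).
  exact: metric_ball_gt0 (Os _ Oz).
have yb z : boundary Omega z -> ball y (s + 1)%R z.
  move=> [/(_ _ (nbhsx_ballx z 1%R ltr01))[w [Ow zw]] _].
  by apply: ball_triangle (Os _ Ow) _; exact: ball_sym.
have r0 : (0 < s + 1 + (s + 1))%R by rewrite !addr_gt0.
have /andP[_ muoo] := mu_ball_Omega (boundary_closure bx) r0.
apply: (@le_lt_trans _ _ (nu (ball x (s + 1 + (s + 1)) `&` boundary Omega))).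
  apply: le_outer_measure => z bz; split=> //.
  by apply: ball_triangle (yb _ bz); apply: ball_sym; exact: yb.
apply: (le_lt_trans (nuC _ _ bx r0)).
by rewrite -EFinM lte_mul_pinfty// lee_fin mulr_ge0 ?powR_ge0// ltW.
Qed.

(* M g need not be shown measurable: its level sets are replaced by Borel hulls,
   which yields a measurable majorant G; e absorbs the levels below s. *)
Lemma frac_maximal_strong (p : R) : (1 < p)%R -> exists2 C : R, (0 < C)%R &
  forall (g : X -> \bar R) (e : R),
    measurable_fun (Omega : set (caratheodory_type mu)) g -> (0 < e)%R ->
    exists G : X -> \bar R, [/\
      measurable_fun (boundary Omega : set (caratheodory_type nu)) G,
      forall z, 0 <= G z,
      forall z, boundary Omega z -> M g z `^ p <= G z &
      \int[cara_measure nu]_(z in boundary Omega) G z <=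
        C%:E * \int[m]_(x in Omega) (`|g x| `^ p) + e%:E].
Proof.
move=> p1; have p0 : (0 < p)%R by apply: lt_trans p1.
have [C [K [C0 K0 weak]]] := frac_maximal_weak.
have [L L0 layers] := dyadic_layer_sum_le p1 K0.
exists (2 `^ p * C * L)%R; first by rewrite !mulr_gt0 ?powR_gt0.
move=> g e mg e0.
have mb := boundary_cara_measurable.
have nufin : nu (boundary Omega) \is a fin_num.
  by rewrite ge0_fin_numE ?outer_measure_ge0// nu_boundary_lt_pinfty.
(* With [s ^ p = e / V] the constant summand of [G] integrates to at most [e]; the added 1 keeps [V]
   positive when the boundary is null. *)
pose V := (fine (nu (boundary Omega)) + 1)%R.
have V0 : (0 < V)%R by rewrite ltr_wpDl// fine_ge0// outer_measure_ge0.
pose s := ((e / V) `^ p^-1)%R.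
have s0 : (0 < s)%R by rewrite powR_gt0// divr_gt0.
have sp : (s `^ p = e / V)%R.
  by rewrite /s -powRrM mulVf ?gt_eqF// powRr1// divr_ge0 ?(ltW e0) ?(ltW V0).
pose t j := (2 ^+ j * s)%R.
have t0 j : (0 < t j)%R by rewrite mulr_gt0 ?exprn_gt0.
pose E j := [set z | boundary Omega z /\ (t j)%:E < M g z].
have [B BP] := choice (fun j => nu_regular.2 (E j)).
have mB j : measurable (B j : set (caratheodory_type nu)).
  by apply: nu_regular.1; have [] := BP j.
pose G z := (s `^ p)%:E + \sum_(j <oo) ((2 * t j) `^ p)%:E * (\1_(B j) z)%:E.
have term_ge0 j z : 0 <= ((2 * t j) `^ p)%:E * (\1_(B j) z)%:E :> \bar R.
  by rewrite mule_ge0 ?lee_fin ?powR_ge0.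
have mindic j : measurable_fun (boundary Omega : set (caratheodory_type nu))
    (fun z => (\1_(B j) z)%:E : \bar R).
  by apply/measurable_EFinP; exact: measurable_indic.
have mterm j : measurable_fun (boundary Omega : set (caratheodory_type nu))
    (fun z => ((2 * t j) `^ p)%:E * (\1_(B j) z)%:E).
  exact: measurable_funeM.
have msum : measurable_fun (boundary Omega : set (caratheodory_type nu))
    (fun z => \sum_(j <oo) ((2 * t j) `^ p)%:E * (\1_(B j) z)%:E).
  have := @ge0_emeasurable_sum _ _ _ (boundary Omega : set (caratheodory_type nu))
    (fun j z => ((2 * t j) `^ p)%:E * (\1_(B j) z)%:E) xpredT.
  by apply.
exists G; split.
- by apply: emeasurable_funD.
- move=> z; apply: adde_ge0; first by rewrite lee_fin powR_ge0.
  by apply: nneseries_ge0 => j _ _.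
- move=> z bz; apply: (le_trans (poweR_le_dyadic_layers p1 s0 _)).
    by rewrite le_max lexx.
  rewrite leeD2l//; apply: lee_nneseries => [j _ _|j _].
    by rewrite mule_ge0 ?lee_fin ?powR_ge0//; case: ifPn.
  rewrite lee_wpmul2l ?lee_fin ?powR_ge0//.
  case: ifPn => tj; last by rewrite lee_fin.
  by rewrite indicE mem_set//; have [_ + _] := BP j; apply.
rewrite ge0_integralD//; last 2 first.
- by move=> z _; rewrite lee_fin powR_ge0.
- by move=> z _; apply: nneseries_ge0 => j _ _.
rewrite addeC; apply: leeD; last first.
  rewrite integral_cst//= sp -(fineK nufin) -EFinM lee_fin.
  rewrite mulrAC ler_pdivrMr// ler_wpM2l ?(ltW e0)//.
  by rewrite lerDl.
rewrite integral_nneseries//.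
have mabs : measurable_fun (Omega : set (caratheodory_type mu)) (abse \o g).
  by apply: measurableT_comp => //; exact: abse_measurable.
have mO : measurable (Omega : set (caratheodory_type mu)).
  exact: open_cara_measurable.
pose h j x := if (t j / K)%:E < `|g x| then `|g x| else 0.
have mh j : measurable_fun (Omega : set (caratheodory_type mu)) (h j).
  apply: measurable_fun_if => //; first exact: measurable_fun_lte.
  by apply: measurable_funS mabs => // x [].
have h0 j x : 0 <= h j x by rewrite /h; case: ifPn.
(* The factor [C / t j] of the weak type estimate lowers the weight [(2 * t j) ^ p] to
   [2 ^ p * C * t j ^ (p - 1)], the weight of the layer sum. *)
apply: (@le_trans _ _ (\sum_(j <oo) (2 `^ p * C)%:E *
    \int[m]_(x in Omega) (((t j) `^ (p - 1))%:E * h j x))).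
  apply: lee_nneseries => [j _ _|j _]; first exact: integral_ge0.
  rewrite ge0_integralZl//; last by rewrite lee_fin powR_ge0.
  rewrite integral_indic// ge0_integralZl//; last by rewrite lee_fin powR_ge0.
  apply: (@le_trans _ _ (((2 * t j) `^ p)%:E * nu (E j))).
    rewrite lee_wpmul2l ?lee_fin ?powR_ge0//.
    by have [_ _ <-] := BP j; apply: le_outer_measure; exact: subIsetl.
  apply: (le_trans (lee_wpmul2l _ (weak _ _ mg (t0 j)))).
    by rewrite lee_fin powR_ge0.
  rewrite integral_mkcondr !muleA -!EFinM.
  rewrite (_ : (2 * t j) `^ p * (C / t j) = 2 `^ p * C * (t j) `^ (p - 1))%R; last first.
    rewrite powRM// ?(ltW (t0 j))// -(mulr_powRB1 (ltW (t0 j)) p0).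
    by field; rewrite gt_eqF.
  rewrite lee_wpmul2l ?lee_fin ?mulr_ge0 ?powR_ge0 ?(ltW C0)//.
  rewrite le_eqVlt; apply/orP; left; apply/eqP; apply: eq_integral => x _.
  by rewrite /h patchE mem_setE.
rewrite nneseriesZl; last first.
  by move=> j _; apply: integral_ge0 => x _; rewrite mule_ge0 ?lee_fin ?powR_ge0.
rewrite -integral_nneseries//; last 2 first.
- by move=> j; apply: measurable_funeM.
- by move=> j x _; rewrite mule_ge0 ?lee_fin ?powR_ge0.
rewrite [in leRHS]EFinM -muleA lee_wpmul2l//.
  by rewrite lee_fin !mulr_ge0 ?powR_ge0// ltW.
have mpow : measurable_fun (Omega : set (caratheodory_type mu))
    (fun x => `|g x| `^ p).
  exact: (measurableT_comp (measurable_poweR _) mabs).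
rewrite -ge0_integralZl ?lee_fin ?(ltW L0)//; last first.
  by move=> x _; exact: poweR_ge0.
apply: ge0_le_integral => //.
- move=> x _; apply: nneseries_ge0 => j _ _.
  by rewrite mule_ge0 ?lee_fin ?powR_ge0.
- have := @ge0_emeasurable_sum _ _ _ (Omega : set (caratheodory_type mu))
    (fun j x => ((t j) `^ (p - 1))%:E * h j x) xpredT.
  apply => [j x _ _|j _]; first by rewrite mule_ge0 ?lee_fin ?powR_ge0.
  exact: measurable_funeM.
- exact: measurable_funeM.
- by move=> x _; exact: layers.
Qed.

End frac_maximal.

(** * Monotonicity of the integral and pointwise bounds for the double-phase function *)

(** The integral of a nonnegative function is a supremum over the simple functions below it, hence
    monotone for arbitrary integrands such as [H z (M g z)]. *)
Lemma ge0_le_integral_nonmeasurable d (T : measurableType d) (R : realType)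
    (m : {measure set T -> \bar R}) (D : set T) (f h : T -> \bar R) :
  (forall x, D x -> 0 <= f x) -> (forall x, D x -> f x <= h x) ->
  \int[m]_(x in D) f x <= \int[m]_(x in D) h x.
Proof.
move=> f0 fh; rewrite integral_mkcond [leRHS]integral_mkcond.
have fh' x : (f \_ D) x <= (h \_ D) x.
  by rewrite !patchE; case: ifPn => // /set_mem; exact: fh.
have f0' x : 0 <= (f \_ D) x by apply: erestrict_ge0.
rewrite !ge0_integralTE//; last by move=> x; apply: le_trans (fh' x).
apply: le_ereal_sup => _ [k kf <-]; exists k => // x.
exact: le_trans (kf x) (fh' x).
Qed.

Section double_phase.
Context (R : realType) (X : Type) (p q a : X -> R).
Local Notation H := (double_phase p q a).

Lemma double_phase_ge0 x xi : (0 <= a x)%R -> 0 <= H x xi.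
Proof. by move=> a0; rewrite adde_ge0 ?mule_ge0 ?lee_fin ?poweR_ge0. Qed.

Lemma le_double_phase x xi eta : (0 <= p x)%R -> (0 <= q x)%R -> (0 <= a x)%R ->
  0 <= xi -> xi <= eta -> H x xi <= H x eta.
Proof.
move=> p0 q0 a0 xi0 xe.
have pow r : (0 <= r)%R -> xi `^ r <= eta `^ r.
  move=> r0; apply: gt0_ler_poweR => //; rewrite in_itv/= leey andbT//.
  exact: le_trans xe.
by apply: leeD; [exact: pow|apply: lee_wpmul2l; [rewrite lee_fin|exact: pow]].
Qed.

Lemma double_phase_pinfty x : (0 < p x)%R -> (0 <= a x)%R -> H x +oo = +oo.
Proof.
move=> p0 a0; rewrite /double_phase poweRyr ?gt_eqF// addye// gt_eqF//.
by rewrite (lt_le_trans ltNy0)// mule_ge0 ?lee_fin ?poweR_ge0.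
Qed.

Lemma double_phaseM x (k : R) xi : (0 <= k)%R -> (0 <= a x)%R -> 0 <= xi ->
  H x (k%:E * xi) <=
    (k `^ p x + k `^ q x)%:E * (xi `^ p x + (a x)%:E * xi `^ q x).
Proof.
move=> k0 a0 xi0; rewrite /double_phase !poweRM ?lee_fin// !poweR_EFin.
have powge r : 0 <= xi `^ r by exact: poweR_ge0.
rewrite ge0_muleDr ?mule_ge0 ?lee_fin//.
apply: leeD; first by rewrite lee_wpmul2r// lee_fin lerDl powR_ge0.
rewrite muleCA lee_wpmul2r ?mule_ge0 ?lee_fin//.
by rewrite lerDr powR_ge0.
Qed.

End double_phase.

(* The measure on the boundary of Omega is given by its extension nu by zero to
   the subsets of X. *)
Theorem lemma3p1 (R : realType) (X : completeMetricType R)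
  (mu nu : {outer_measure set X -> \bar R})
  (Omega : set X) (theta : R) (p q a : X -> R)
  (mu_regular : borel_regular mu)
  (mu_sigma_finite : sigma_finite (setT : set (caratheodory_type mu)) (cara_measure mu))
  (mu_ball : forall (x : X) (r : R), (0 < r)%R -> 0 < mu (ball x r) < +oo)
  (Omega_domain : domain Omega)
  (mu_ball_Omega : forall (x : X) (r : R), closure Omega x -> (0 < r)%R ->
     0 < mu (ball x r `&` Omega) < +oo)
  (mu_doubling : restricted_doubling mu Omega)
  (theta_range : (0 <= theta < 1)%R)
  (nu_boundary : nu (~` boundary Omega) = 0)
  (nu_regular : borel_regular nu)
  (nu_sigma_finite :
     sigma_finite (boundary Omega : set (caratheodory_type nu))
       (cara_measure nu))
  (nu_codim : upper_codimension mu nu Omega theta)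
  (H_mu : double_phase_data (cara_measure mu) (closure Omega) p q a)
  (H_nu : double_phase_data (cara_measure nu) (boundary Omega) p q a)
  (Omega_bounded : metric_bounded Omega)
  (H_comparable : local_comparability (double_phase p q a) (closure Omega)) :
  exists2 C : R, (0 < C)%R &
    forall g : X -> \bar R,
      modular_space mu Omega (double_phase p q a) g ->
      \int[cara_measure nu]_(z in boundary Omega)
          double_phase p q a z (frac_maximal mu Omega theta g z)
      <= C%:E * \int[cara_measure mu]_(x in Omega)
                    double_phase p q a x (C%:E * `|g x|).
Proof.
have [openO connO [x0 Ox0]] := Omega_domain.
have theta0 : (0 <= theta)%R by case/andP: theta_range.
have data x : closure Omega x -> [/\ (1 < p x)%R, (1 < q x)%R & (0 <= a x)%R].
  have [_ + _ _ _] := H_mu => /[apply] -[p1 pq a0].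
  by split=> //; exact: lt_trans pq.
set H := double_phase p q a.
have H_ge0 x xi : closure Omega x -> 0 <= xi -> 0 <= H x xi.
  by move=> /data[_ _ a0] _; exact: double_phase_ge0.
have le_H x xi eta : closure Omega x -> 0 <= xi -> xi <= eta -> H x xi <= H x eta.
  move=> /data[p1 q1 a0]; apply: le_double_phase => //.
  - exact: ltW (lt_trans ltr01 p1).
  - exact: ltW (lt_trans ltr01 q1).
have Hoo x : closure Omega x -> H x +oo = +oo.
  by move=> /data[p1 _ a0]; apply: double_phase_pinfty => //; exact: lt_trans p1.
have [K K1 cmpK] := global_comparability mu_regular openO mu_ball_Omega
  mu_doubling Omega_bounded connO H_ge0 le_H H_comparable Ox0.
have K0 : (0 < K)%R by apply: lt_le_trans K1.
have [p1 q1 a0] := data x0 (subset_closure Ox0).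
(* Comparability extends to infinite arguments because [H] is infinite there. *)
have cmp x xi : closure Omega x -> 0 <= xi ->
    H x xi <= K%:E * H x0 (K%:E * xi) /\ H x0 xi <= K%:E * H x (K%:E * xi).
  have Ox0' := subset_closure Ox0.
  case: xi => [xi|Ox _|//]; last first.
    by rewrite gt0_muley ?lte_fin// !Hoo// gt0_muley ?lte_fin ?leey.
  by rewrite lee_fin -EFinM => Ox; exact: cmpK.
have [C1 C10 strong1] := frac_maximal_strong mu_regular nu_regular openO
  mu_ball_Omega mu_doubling Omega_bounded theta0 nu_codim p1.
have [C2 C20 strong2] := frac_maximal_strong mu_regular nu_regular openO
  mu_ball_Omega mu_doubling Omega_bounded theta0 nu_codim q1.
pose L := (K `^ p x0 + K `^ q x0)%R.
have L0 : (0 < L)%R by rewrite addr_gt0 ?powR_gt0.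
pose D := (C1 + C2)%R.
have D0 : (0 < D)%R by rewrite addr_gt0.
(* The product is the factor in front of the integral; the summand [K] ensures [K <= C], needed
   inside [H]. *)
exists (K * L * D * K + K)%R; first by rewrite addr_gt0 ?mulr_gt0.
set C := (K * L * D * K + K)%R.
have KC : (K <= C)%R by rewrite lerDr !mulr_ge0// ltW.
move=> g [mg _].
set W := (X in _ <= _ * X).
have W0 : 0 <= W.
  apply: integral_ge0 => x Ox; apply: H_ge0; first exact: subset_closure.
  by rewrite mule_ge0 ?lee_fin ?(le_trans _ KC) ?(ltW K0).
have mO : measurable (Omega : set (caratheodory_type mu)).
  exact: open_cara_measurable.
have mabs : measurable_fun (Omega : set (caratheodory_type mu)) (abse \o g).
  by apply: measurableT_comp => //; exact: abse_measurable.
have mpow r : measurable_fun (Omega : set (caratheodory_type mu))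
    (fun x => `|g x| `^ r).
  exact: (measurableT_comp (measurable_poweR _) mabs).
pose Ip := \int[cara_measure mu]_(x in Omega) (`|g x| `^ p x0).
pose Iq := \int[cara_measure mu]_(x in Omega) (`|g x| `^ q x0).
have Ip0 : 0 <= Ip by apply: integral_ge0 => x _; exact: poweR_ge0.
have Iq0 : 0 <= Iq by apply: integral_ge0 => x _; exact: poweR_ge0.
have IW : Ip + (a x0)%:E * Iq <= K%:E * W.
  have pow0 r x : 0 <= `|g x| `^ r by exact: poweR_ge0.
  have apow0 x : 0 <= (a x0)%:E * `|g x| `^ q x0 by rewrite mule_ge0 ?lee_fin.
  have mapow : measurable_fun (Omega : set (caratheodory_type mu))
      (fun x => (a x0)%:E * `|g x| `^ q x0).
    exact: measurable_funeM.
  rewrite /Ip /Iq -ge0_integralZl ?lee_fin// -ge0_integralD//.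
  rewrite -lee_pdivrMl// -ge0_integralZl ?lee_fin ?invr_ge0 ?(ltW K0)//.
  - apply: ge0_le_integral_nonmeasurable => x Ox.
      by rewrite mule_ge0 ?lee_fin ?invr_ge0 ?(ltW K0)// adde_ge0.
    have Ox' := subset_closure Ox.
    have [_] := cmp x `|g x| Ox' (abse_ge0 _).
    rewrite -lee_pdivrMl// => /le_trans; apply; apply: le_H => //.
      by rewrite mule_ge0 ?lee_fin ?(ltW K0).
    by rewrite lee_wpmul2r ?lee_fin.
  - exact: emeasurable_funD.
  - by move=> x _; rewrite adde_ge0.
apply/lee_addgt0Pr => e' e'0.
(* The two majorants lose [(1 + a x0) * e] together, which the factor [K * L] turns into exactly
   [e']. *)
pose e := (e' / (K * L * (1 + a x0)))%R.
have a10 : (0 < 1 + a x0)%R by rewrite ltr_pwDl.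
have e0 : (0 < e)%R by rewrite divr_gt0 ?mulr_gt0.
have [G1 [mG1 G10 MG1 intG1]] := strong1 g e mg e0.
have [G2 [mG2 G20 MG2 intG2]] := strong2 g e mg e0.
have mb := @boundary_cara_measurable _ _ nu Omega nu_regular.
(* Comparability in the other direction freezes the exponents at [x0], where [G1] and [G2] dominate
   the two powers of the maximal function. *)
apply: (@le_trans _ _ (\int[cara_measure nu]_(z in boundary Omega)
    ((K * L)%:E * (G1 z + (a x0)%:E * G2 z)))).
  apply: ge0_le_integral_nonmeasurable => z bz.
    apply: H_ge0; first exact: boundary_closure.
    by rewrite le_max lexx.
  have M0 : 0 <= frac_maximal mu Omega theta g z by rewrite le_max lexx.
  have [+ _] := cmp z _ (boundary_closure bz) M0.
  move=> /le_trans; apply; rewrite EFinM -muleA lee_pmul2l//.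
  apply: (le_trans (double_phaseM p q (ltW K0) a0 M0)).
  rewrite lee_pmul2l//; apply: leeD; first exact: MG1.
  by apply: lee_wpmul2l; [rewrite lee_fin|exact: MG2].
have maG2 : measurable_fun (boundary Omega : set (caratheodory_type nu))
    (fun z => (a x0)%:E * G2 z).
  exact: measurable_funeM.
have aG20 z : 0 <= (a x0)%:E * G2 z by rewrite mule_ge0 ?lee_fin.
rewrite ge0_integralZl//; last 3 first.
- exact: emeasurable_funD.
- by move=> z _; rewrite adde_ge0.
- by rewrite lee_fin mulr_ge0 ?ltW.
rewrite ge0_integralD// ge0_integralZl//.
have {}intG1 : \int[cara_measure nu]_(z in boundary Omega) G1 z <= D%:E * Ip + e%:E.
  apply: (le_trans intG1); rewrite leeD2r// lee_wpmul2r// lee_fin lerDl ltW//.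
have {}intG2 : \int[cara_measure nu]_(z in boundary Omega) G2 z <= D%:E * Iq + e%:E.
  apply: (le_trans intG2); rewrite leeD2r// lee_wpmul2r// lee_fin lerDr ltW//.
apply: (@le_trans _ _ ((K * L)%:E * (D%:E * (K%:E * W) + ((1 + a x0) * e)%:E))).
  rewrite lee_pmul2l ?lte_fin ?mulr_gt0//.
  apply: (@le_trans _ _ ((D%:E * Ip + e%:E) + (a x0)%:E * (D%:E * Iq + e%:E))).
    by apply: leeD => //; apply: lee_wpmul2l; rewrite ?lee_fin.
  apply: (@le_trans _ _ (D%:E * (Ip + (a x0)%:E * Iq) + ((1 + a x0) * e)%:E)).
    have DI0 : 0 <= D%:E * Iq by rewrite mule_ge0 ?lee_fin ?(ltW D0).
    rewrite [(a x0)%:E * (_ + _)]ge0_muleDr ?lee_fin ?(ltW e0)//.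
    rewrite [in leRHS]ge0_muleDr ?mule_ge0 ?lee_fin// mulrDl mul1r.
    by rewrite [(a x0)%:E * (D%:E * Iq)]muleCA [leLHS]addeACA
      [(e + _)%:E]EFinD [(a x0 * e)%:E]EFinM.
  by rewrite leeD2r// lee_wpmul2l// lee_fin ltW.
rewrite ge0_muleDr; last 2 first.
- by rewrite !mule_ge0 ?lee_fin ?(ltW D0) ?(ltW K0).
- by rewrite lee_fin (mulr_ge0 (ltW a10) (ltW e0)).
apply: leeD; last first.
  by rewrite -EFinM lee_fin mulrA /e mulrC divfK// gt_eqF// !mulr_gt0.
by rewrite !muleA -!EFinM lee_wpmul2r// lee_fin lerDl ltW.
Qed.
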